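(* Assume exactness, i.e. $\operatorname{argmin}_{x\in\mathbb{R}^n} f(x)=\mathcal{L}$. Let $y_0=0$ and let $\{y_k\}_{k\ge0}$ be the dual iterates of iSDSA with stepsize $\omega\in(0,2)$. Let $x_*=\Pi_{\mathcal{L},\mathbf{B}}(x_0)$, let $y_*$ be any dual optimal solution (maximizer of $D$ over $\mathbb{R}^m$), and let $\rho=1-\omega(2-\omega)\lambda_{\min}^+$. Suppose the inexactness errors $\epsilon_k^d$ satisfy, for all $k\ge0$, $$\mathbb{E}\big[\|\mathbf{B}^{-1}\mathbf{A}^\top\epsilon_k^d\|_{\mathbf{B}}^2\mid y_k,\mathbf{S}_k\big]\le 2q^2\big[D(y_* )-D(y_k)\big],$$ where $0\le q<1-\sqrt{\rho}$. Then for all $k\ge0$ $$\mathbb{E}[D(y_* )-D(y_k)]\le(\sqrt{\rho}+q)^{2k}\,[D(y_* )-D(y_0)].$$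
   Context: Let $\mathbf{A}\in\mathbb{R}^{m\times n}$, $b\in\mathbb{R}^m$ be such that the linear system $\mathbf{A}x=b$ is consistent, and let $\mathcal{L}=\{x:\mathbf{A}x=b\}$. Let $\mathbf{B}\in\mathbb{R}^{n\times n}$ be symmetric positive definite, $\|x\|_{\mathbf{B}}=\sqrt{x^\top\mathbf{B}x}$ and $\|x\|_{\mathbf{B}^{-1}}=\sqrt{x^\top\mathbf{B}^{-1}x}$. $\Pi_{\mathcal{L},\mathbf{B}}(x)=\operatorname{argmin}_{x'\in\mathcal{L}}\|x'-x\|_{\mathbf{B}}$. $^\dagger$ is the Moore-Penrose pseudoinverse. Fix $x_0\in\mathbb{R}^n$. The dual objective is $$D(y)=(b-\mathbf{A}x_0)^\top y-\tfrac12\|\mathbf{A}^\top y\|_{\mathbf{B}^{-1}}^2,\qquad y\in\mathbb{R}^m.$$ Let $\mathcal{D}$ be a distribution over real matrices $\mathbf{S}$ with $m$ rows. For $\mathbf{S}\sim\mathcal{D}$ put $\mathbf{H}=\mathbf{S}(\mathbf{S}^\top\mathbf{A}\mathbf{B}^{-1}\mathbf{A}^\top\mathbf{S})^\dagger\mathbf{S}^\top$, $\mathbf{Z}=\mathbf{A}^\top\mathbf{H}\mathbf{A}$, $f_{\mathbf{S}}(x)=\frac12(\mathbf{A}x-b)^\top\mathbf{H}(\mathbf{A}x-b)$, and $f(x)=\mathbb{E}_{\mathbf{S}\sim\mathcal{D}}[f_{\mathbf{S}}(x)]$ (all expectations assumed to exist). Let $\mathbf{W}=\mathbf{B}^{-1/2}\mathbb{E}[\mathbf{Z}]\mathbf{B}^{-1/2}$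 and let $\lambda_{\min}^+$ be its smallest nonzero eigenvalue. iSDSA (inexact stochastic dual subspace ascent): with $y_0=0\in\mathbb{R}^m$, for $k=0,1,2,\dots$ draw a fresh sample $\mathbf{S}_k\sim\mathcal{D}$ (independent of the past, in particular of $y_k$) and set $$y_{k+1}=y_k+\omega\mathbf{S}_k(\mathbf{S}_k^\top\mathbf{A}\mathbf{B}^{-1}\mathbf{A}^\top\mathbf{S}_k)^\dagger\mathbf{S}_k^\top\big(b-\mathbf{A}(x_0+\mathbf{B}^{-1}\mathbf{A}^\top y_k)\big)+\epsilon_k^d,$$ where the random vector $\epsilon_k^d\in\mathbb{R}^m$ is the dual inexactness error. *)

(* Defs.v *)
From HB Require Import structures.
From mathcomp Require Export all_boot all_order all_algebra.
From mathcomp Require Export all_classical all_reals all_analysis.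
From mathcomp Require Export measurable_realfun.
Export Order.TTheory GRing.Theory Num.Theory.
Export numFieldNormedType.Exports.
Set Implicit Arguments.
Unset Strict Implicit.
Unset Printing Implicit Defensive.
Local Open Scope classical_set_scope.
Local Open Scope ring_scope.

Section LinearAlgebra.
Context {R : realType}.

Definition qform n (M : 'M[R]_n) (x : 'cV[R]_n) : R := (x^T *m M *m x) 0 0.

Definition posdef n (M : 'M[R]_n) : Prop :=
  M^T = M /\ forall x : 'cV[R]_n, x != 0 -> 0 < qform M x.

Definition mnorm n (M : 'M[R]_n) (x : 'cV[R]_n) : R := Num.sqrt (qform M x).

Definition penrose m n (M : 'M[R]_(m, n)) (X : 'M[R]_(n, m)) : Prop :=
  [/\ M *m X *m M = M, X *m M *m X = X,
      (M *m X)^T = M *m X & (X *m M)^T = X *m M].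

(* Moore-Penrose pseudoinverse: the unique solution of the Penrose equations.
   (The library's [pinvmx] is only a generalized inverse, not this one.) *)
Definition mp_pinv m n (M : 'M[R]_(m, n)) : 'M[R]_(n, m) :=
  xget 0 [set X | penrose M X].

(* The unique positive definite square root, when M is positive definite. *)
Definition posdef_sqrt n (M : 'M[R]_n) : 'M[R]_n :=
  xget 0 [set X | posdef X /\ X *m X = M].

Definition smallest_nonzero_eigenvalue n (M : 'M[R]_n) (a : R) : Prop :=
  [/\ eigenvalue M a, a != 0 &
      forall c : R, eigenvalue M c -> c != 0 -> a <= c].

Definition solution_set m n (A : 'M[R]_(m, n)) (b : 'cV[R]_m) :
  set 'cV[R]_n := [set x | A *m x = b].

Definition is_projection n (L : set 'cV[R]_n) (M : 'M[R]_n)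
    (x xs : 'cV[R]_n) : Prop :=
  L xs /\ forall z, L z -> mnorm M (xs - x) <= mnorm M (z - x).

Definition dual_obj m n (A : 'M[R]_(m, n)) (b : 'cV[R]_m) (B : 'M[R]_n)
    (x0 : 'cV[R]_n) (y : 'cV[R]_m) : R :=
  ((b - A *m x0)^T *m y) 0 0 - 2^-1 * mnorm (invmx B) (A^T *m y) ^+ 2.

End LinearAlgebra.

(* Real matrices with m rows; the number of columns is part of the value, so
   that it may be random. *)
Definition sketch (R : realType) (m : nat) : Type := {q : nat & 'M[R]_(m, q)}.

HB.instance Definition _ (R : realType) m := Choice.on (sketch R m).
HB.instance Definition _ (R : realType) m :=
  isPointed.Build (sketch R m)
    (existT (fun q => 'M[R]_(m, q)) 0%N (0 : 'M[R]_(m, 0))).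

(* Generators of the Borel sigma-algebra of the disjoint union over q of the
   spaces of m x q matrices. *)
Definition sketch_events (R : realType) (m : nat) : set_system (sketch R m) :=
  [set E | (exists q : nat, E = [set s | tag s = q]) \/
           (exists (q : nat) (i : 'I_m) (j : 'I_q) (U : set R),
              measurable U /\
              E = [set s | exists2 M : 'M[R]_(m, q),
                             s = existT _ q M & U (M i j)])].

Definition sketchT (R : realType) (m : nat) :=
  g_sigma_algebraType (@sketch_events R m).

Section Sketching.
Context {R : realType} (m n : nat).
Variables (A : 'M[R]_(m, n)) (b : 'cV[R]_m) (B : 'M[R]_n).

Definition Hmx (s : sketchT R m) : 'M[R]_m :=
  let S := tagged s in
  S *m mp_pinv (S^T *m A *m invmx B *m A^T *m S) *m S^T.

Definition Zmx (s : sketchT R m) : 'M[R]_n := A^T *m Hmx s *m A.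

Definition f_sketch (s : sketchT R m) (x : 'cV[R]_n) : R :=
  2^-1 * qform (Hmx s) (A *m x - b).

Definition f_mean (mu : probability (sketchT R m) R) (x : 'cV[R]_n) : \bar R :=
  'E_mu[fun s => f_sketch s x]%E.

Definition EZ (mu : probability (sketchT R m) R) : 'M[R]_n :=
  \matrix_(i, j) fine ('E_mu[fun s => Zmx s i j])%E.

Definition Wmx (mu : probability (sketchT R m) R) : 'M[R]_n :=
  invmx (posdef_sqrt B) *m EZ mu *m invmx (posdef_sqrt B).

Definition exactness (mu : probability (sketchT R m) R) : Prop :=
  [set x | forall z, (f_mean mu x <= f_mean mu z)%E] = solution_set A b.

Definition isdsa_step (x0 : 'cV[R]_n) (omega : R) (y : 'cV[R]_m)
    (s : sketchT R m) (eps : 'cV[R]_m) : 'cV[R]_m :=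
  y + omega *: (Hmx s *m (b - A *m (x0 + invmx B *m A^T *m y))) + eps.

Fixpoint isdsa (Omega : Type) (x0 : 'cV[R]_n) (omega : R)
    (S : nat -> Omega -> sketchT R m) (eps : nat -> Omega -> 'cV[R]_m)
    (k : nat) (w : Omega) : 'cV[R]_m :=
  if k is k'.+1
  then isdsa_step x0 omega (isdsa x0 omega S eps k' w) (S k' w) (eps k' w)
  else 0.

End Sketching.

Section Probability.
Context {d : measure_display} {Omega : measurableType d} {R : realType}.

(* Events generating the sigma-algebras of a random vector and of a random
   sketching matrix. *)
Definition vector_events m (Y : Omega -> 'cV[R]_m) : set_system Omega :=
  \bigcup_(i in [set: 'I_m])
     preimage_set_system setT (fun w => Y w i 0) measurable.

Definition sample_events m (S : Omega -> sketchT R m) : set_system Omega :=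
  preimage_set_system setT S measurable.

(* History of the algorithm just before the k-th sample is drawn:
   y_0, ..., y_k and S_0, ..., S_(k-1). *)
Definition past_events m (y : nat -> Omega -> 'cV[R]_m)
    (S : nat -> Omega -> sketchT R m) (k : nat) : set_system Omega :=
  \bigcup_(j in `I_k.+1) vector_events (y j) `|`
  \bigcup_(j in `I_k) sample_events (S j).

Definition independent (P : probability Omega R) (F G : set_system Omega) :
    Prop :=
  forall E1 E2, F E1 -> G E2 -> P (E1 `&` E2) = (P E1 * P E2)%E.

(* g is a version of E[X | G], for a nonnegative X (no integrability needed)
   and a sub-sigma-algebra G. *)
Definition is_cond_exp (P : probability Omega R) (G : set_system Omega)
    (X g : Omega -> \bar R) : Prop :=
  [/\ forall w, (0 <= g w)%E,
      forall U : set (\bar R), measurable U -> G (g @^-1` U) &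
      forall E, G E -> (\int[P]_(w in E) g w = \int[P]_(w in E) X w)%E].

End Probability.

(* Main.v *)
(* With u_k = A^T (y_k - ys), optimality of ys gives
   D(ys) - D(y_k) = 1/2 |u_k|^2 in the B^-1-norm, and the iteration becomes
   u_{k+1} = u_k - omega Z_k B^-1 u_k + A^T eps_k, driven by Z_k alone. Since
   Z B^-1 Z = Z, the exact part contracts |u_k|^2 by
   omega (2 - omega) (B^-1 u_k)^T Z_k (B^-1 u_k). Independence replaces Z_k by
   E[Z] in the mean; exactness says ker E[Z] = ker A, so u_k lies in the range
   of E[Z], where the Rayleigh quotient is at least lambda_min^+. Minkowski's
   inequality then adds the error term to the factor sqrt(rho).
   Working with Z rather than H matters for measurability: only the entries of
   Z are known to be measurable, so y_k itself may fail to be. For the same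
   reason the conditional expectation of the error may be non-measurable; only
   its integral over the whole space is used. *)
Require Import Defs.
From mathcomp Require Import ring lra.
Set Implicit Arguments.
Unset Strict Implicit.
Unset Printing Implicit Defensive.
Local Open Scope classical_set_scope.
Local Open Scope ring_scope.

(** * Quadratic and bilinear forms *)

Section QuadraticForms.
Context {R : realType}.

Definition bform n (M : 'M[R]_n) (x y : 'cV[R]_n) : R := (x^T *m M *m y) 0 0.

Lemma qformE n (M : 'M[R]_n) x : qform M x = bform M x x. Proof. by []. Qed.

Lemma bformDl n (M : 'M[R]_n) x1 x2 y :
  bform M (x1 + x2) y = bform M x1 y + bform M x2 y.
Proof. by rewrite /bform linearD /= !mulmxDl mxE. Qed.

Lemma bformDr n (M : 'M[R]_n) x y1 y2 :
  bform M x (y1 + y2) = bform M x y1 + bform M x y2.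
Proof. by rewrite /bform !mulmxDr mxE. Qed.

Lemma bformZl n (M : 'M[R]_n) a x y : bform M (a *: x) y = a * bform M x y.
Proof. by rewrite /bform linearZ /= -!scalemxAl mxE. Qed.

Lemma bformZr n (M : 'M[R]_n) a x y : bform M x (a *: y) = a * bform M x y.
Proof. by rewrite /bform -!scalemxAr mxE. Qed.

Lemma bformC n (M : 'M[R]_n) x y : M^T = M -> bform M x y = bform M y x.
Proof.
move=> Ms; transitivity ((x^T *m M *m y)^T 0 0); first by rewrite [RHS]mxE.
by rewrite !trmx_mul trmxK Ms mulmxA.
Qed.

Lemma bformE n (M : 'M[R]_n) x y :
  bform M x y = \sum_i \sum_j x i 0 * M i j * y j 0.
Proof.
rewrite /bform mxE exchange_big; apply: eq_bigr => j _ /=.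
by rewrite mxE mulr_suml; apply: eq_bigr => i _; rewrite mxE.
Qed.

Lemma qformD n (M : 'M[R]_n) x y : M^T = M ->
  qform M (x + y) = qform M x + 2 * bform M x y + qform M y.
Proof.
move=> Ms; rewrite !qformE !bformDl !bformDr (bformC y x Ms); ring.
Qed.

Lemma qformZ n (M : 'M[R]_n) a x : qform M (a *: x) = a ^+ 2 * qform M x.
Proof. by rewrite !qformE bformZl bformZr mulrA. Qed.

Lemma qform0 n (M : 'M[R]_n) : qform M 0 = 0.
Proof. by rewrite /qform mulmx0 mxE. Qed.

Lemma qformB_mx n (M N : 'M[R]_n) x : qform (M - N) x = qform M x - qform N x.
Proof. by rewrite /qform mulmxBr mulmxBl !mxE. Qed.

Lemma qformZ_mx n a (M : 'M[R]_n) x : qform (a *: M) x = a * qform M x.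
Proof. by rewrite /qform -scalemxAr -scalemxAl mxE. Qed.

Lemma qform_congr n p (M : 'M[R]_n) (C : 'M[R]_(n, p)) x :
  qform (C^T *m M *m C) x = qform M (C *m x).
Proof. by rewrite /qform trmx_mul !mulmxA. Qed.

Lemma qform1_eq0 n (x : 'cV[R]_n) : (qform 1%:M x == 0) = (x == 0).
Proof.
apply/eqP/eqP => [|->]; last exact: qform0.
rewrite /qform mulmx1 mxE => /eqP; rewrite psumr_eq0; last first.
  by move=> i _; rewrite mxE -expr2 sqr_ge0.
move=> /allP x0; apply/matrixP => i j; rewrite ord1 [RHS]mxE; apply/eqP.
by move: (x0 i (mem_index_enum i)); rewrite mxE mulf_eq0 orbb.
Qed.

Lemma qform1_ge0 n (x : 'cV[R]_n) : 0 <= qform 1%:M x.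
Proof.
by rewrite /qform mulmx1 mxE sumr_ge0// => i _; rewrite mxE -expr2 sqr_ge0.
Qed.

Lemma qform1_gt0 n (x : 'cV[R]_n) : x != 0 -> 0 < qform 1%:M x.
Proof. by move=> x0; rewrite lt_def qform1_ge0 qform1_eq0 x0. Qed.

(** Near 0 the linear term dominates. This replaces differentiation in every variational argument
    below. *)
Lemma linear_coef_eq0 (a c : R) :
  (forall t, 0 <= t * a + t ^+ 2 * c) -> a = 0.
Proof.
move=> h; have k0 : 0 < `|c| + 1 by apply: ltr_wpDl.
(* At this point the linear part outweighs the quadratic one and leaves [s ^+ 2 <= 0]; the [+ 1]
   keeps the denominator positive when [c = 0]. *)
have := h (- (a / (`|c| + 1))).
set s := a / (`|c| + 1).
have sE : a = s * (`|c| + 1) by rewrite /s divfK ?gt_eqF.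
have sc : s ^+ 2 * c <= s ^+ 2 * `|c|.
  by apply: ler_wpM2l; [exact: sqr_ge0|exact: ler_norm].
rewrite sqrrN {1}sE mulNr => h1.
have : s ^+ 2 <= 0 by move: h1; rewrite mulrA -expr2 mulrDr mulr1; lra.
by rewrite sE le_eqVlt ltNge sqr_ge0 orbF sqrf_eq0 => /eqP ->; rewrite mul0r.
Qed.

(* First-order condition at a minimizer [x] of [M] over [V], in the direction
   [M *m x]. *)
Lemma qform_eq0_ker n (M : 'M[R]_n) (V : set 'cV[R]_n) x : M^T = M ->
  (forall t v, V v -> 0 <= qform M (x + t *: v)) -> V (M *m x) ->
  qform M x = 0 -> M *m x = 0.
Proof.
move=> Ms M0 Vx qx; apply/eqP; rewrite -qform1_eq0; apply/eqP.
set v := M *m x; set a := qform 1%:M v.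
have bE : bform M x v = a by rewrite /bform /a /qform /v trmx_mul Ms mulmx1.
suff: 2 * a = 0 by lra.
apply: (@linear_coef_eq0 _ (qform M v)) => t.
have := M0 t _ Vx; rewrite qformD// qx bformZr bE qformZ; lra.
Qed.

End QuadraticForms.

(** * Rayleigh quotients on the range of a symmetric matrix *)

Section Rayleigh.
Context {R : realType} (n : nat).
Implicit Types (M W : 'M[R]_n).

Lemma continuous_mul (T : topologicalType) (f g : T -> R) :
  continuous f -> continuous g -> continuous (fun x => f x * g x).
Proof. by move=> cf cg x; apply: cvgM; [exact: cf|exact: cg]. Qed.

(** Row vectors appear because [EVT_min_rV], which yields the minimizer, is stated for them. *)
Lemma continuous_qform_tr M : continuous (fun r : 'rV[R]_n => qform M r^T).
Proof.
have -> : (fun r : 'rV[R]_n => qform M r^T) =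
    (fun r : 'rV[R]_n => \sum_i \sum_j r 0 i * M i j * r 0 j).
  apply/funext => r; rewrite qformE bformE.
  by apply: eq_bigr => i _; apply: eq_bigr => j _; rewrite !mxE.
apply: continuous_big => [|i _]; first exact: add_continuous.
apply: continuous_big => [|j _]; first exact: add_continuous.
apply: continuous_mul; last exact: coord_continuous.
by apply: continuous_mul; [exact: coord_continuous|exact: cst_continuous].
Qed.

Lemma closed_ker p (K : 'M[R]_(n, p)) : closed [set r : 'rV[R]_n | r *m K = 0].
Proof.
have -> : [set r : 'rV[R]_n | r *m K = 0] =
    \bigcap_(j in [set: 'I_p])
      ((fun r : 'rV[R]_n => \sum_i r 0 i * K i j) @^-1` [set 0]).
  apply/seteqP; split => [r /= rK j _|r /= rK].
    by have /matrixP/(_ 0 j) := rK; rewrite !mxE.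
  by apply/matrixP => i j; rewrite ord1 !mxE; exact: (rK j I).
apply: closed_bigI => j _; apply: preimage_closed; last first.
  exact: (accessible_closed_set1 (@hausdorff_accessible _ (@Rhausdorff R))).
move=> r _; apply: continuous_big => [|i _]; first exact: add_continuous.
by apply: continuous_mul; [exact: coord_continuous|exact: cst_continuous].
Qed.

(** With [K := cokermx W] and [W] symmetric, this is the unit sphere of the range of [W],
    transposed. *)
Lemma unit_sphere_compact (K : 'M[R]_n) :
  compact [set r : 'rV[R]_n | r *m K = 0 /\ qform 1%:M r^T = 1].
Proof.
apply: bounded_closed_compact.
  (* The matrix norm is the largest absolute value of an entry, and the square of each entry is one
     term of a sum equal to 1. *)
  exists 1; split => [|M M1 r [_ r1]]; first exact: num_real.
  apply: le_trans (ltW M1); rewrite /Num.Def.normr /= mx_normrE.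
  apply/bigmax_leP; split => //= -[i j] _ /=; rewrite ord1.
  rewrite -(@expr_le1 _ 2)// real_normK ?num_real// -r1 /qform mulmx1 mxE.
  rewrite (bigD1 j)//= !mxE -expr2.
  by rewrite lerDl sumr_ge0// => k _; rewrite !mxE -expr2 sqr_ge0.
apply: closedI; first exact: closed_ker.
apply: (@preimage_closed _ _ (fun r : 'rV[R]_n => qform 1%:M r^T) [set 1]).
  by move=> r _; exact: continuous_qform_tr.
exact: (accessible_closed_set1 (@hausdorff_accessible _ (@Rhausdorff R))).
Qed.

(* A minimizer of the Rayleigh quotient over the range of [W] is an
   eigenvector, and its eigenvalue is nonzero because range and kernel of a
   symmetric matrix are orthogonal. *)
Lemma rayleigh_range W (lmin : R) : W^T = W ->
  (forall c, eigenvalue W c -> c != 0 -> lmin <= c) ->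
  forall z, lmin * qform 1%:M (W *m z) <= qform W (W *m z).
Proof.
move=> Ws Wl z.
have [->|x0] := eqVneq (W *m z) 0; first by rewrite !qform0 mulr0.
set V := [set x : 'cV[R]_n | x^T *m cokermx W = 0].
have VP x : V x <-> exists z, x = W *m z.
  split=> [/eqP|[u ->]]; last first.
    by rewrite /V /= trmx_mul Ws -mulmxA mulmx_coker mulmx0.
  rewrite -submxE => /submxP[D xD]; exists D^T.
  by rewrite -{1}Ws -trmx_mul -xD trmxK.
have VZ a x : V x -> V (a *: x).
  by rewrite /V /= => Vx; rewrite linearZ /= -scalemxAl Vx scaler0.
have VD x y : V x -> V y -> V (x + y).
  by rewrite /V /= => Vx Vy; rewrite linearD /= mulmxDl Vx Vy addr0.
pose nrm (x : 'cV[R]_n) := (Num.sqrt (qform 1%:M x))^-1 *: x.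
have nrm1 x : x != 0 -> qform 1%:M (nrm x) = 1.
  move=> xn0; rewrite /nrm qformZ exprVn sqr_sqrtr ?qform1_ge0// mulVf//.
  by rewrite qform1_eq0.
have [] := @EVT_min_rV R n (fun r => qform W r^T) _ _
  (@unit_sphere_compact (cokermx W)).
- exists (nrm (W *m z))^T; split => /=; last by rewrite trmxK nrm1.
  by apply: VZ; apply/VP; exists z.
- by apply: continuous_subspaceT; exact: continuous_qform_tr.
move=> r /set_mem[/= Vr r1] rmin; set c := qform W r^T in rmin.
have Vrt : V r^T by rewrite /V /= trmxK.
(* Homogeneity extends the minimum from the unit sphere to all of [V]. *)
have cmin x : V x -> c * qform 1%:M x <= qform W x.
  move=> Vx; have [->|xn0] := eqVneq x 0; first by rewrite !qform0 mulr0.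
  have /rmin : (nrm x)^T \in [set r : 'rV[R]_n |
      r *m cokermx W = 0 /\ qform 1%:M r^T = 1].
    by apply/mem_set; split; [exact: VZ|rewrite trmxK nrm1].
  rewrite trmxK /nrm qformZ exprVn sqr_sqrtr ?qform1_ge0//.
  by rewrite mulrC ler_pdivlMr// qform1_gt0.
set M := W - c%:M.
have ME x : qform M x = qform W x - c * qform 1%:M x.
  by rewrite /M -[c%:M]scalemx1 qformB_mx qformZ_mx.
have Ms : M^T = M by rewrite /M linearB /= Ws tr_scalar_mx.
(* [M] is nonnegative on [V] and vanishes at [r^T], and [V] is stable under [M], so the first-order
   condition applies. *)
have rker : M *m r^T = 0.
  apply: (@qform_eq0_ker _ _ _ V) => //.
  - move=> t v Vv; rewrite ME subr_ge0; apply: cmin.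
    by apply: VD => //; exact: VZ.
  - rewrite /M mulmxBl -mulNmx; apply: VD; first by apply/VP; exists r^T.
    by rewrite mulNmx mul_scalar_mx -scaleNr; exact: VZ.
  - by rewrite ME r1 mulr1 subrr.
have rW : r *m W = c *: r.
  apply: trmx_inj; rewrite trmx_mul Ws linearZ /=.
  by apply/eqP; rewrite -subr_eq0 -mul_scalar_mx -mulmxBl rker.
have r0 : r != 0.
  by apply: contra_eq_neq r1 => ->; rewrite trmx0 qform0 eq_sym oner_eq0.
apply: le_trans (cmin _ _); last by apply/VP; exists z.
apply: ler_wpM2r; first exact: qform1_ge0.
apply: Wl; first by apply/eigenvalueP; exists r.
apply/eqP => c0; have [u ru] := (VP _).1 Vrt.
move: r1; rewrite /qform mulmx1 trmxK ru mulmxA rW c0 scale0r mul0mx mxE.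
by move/esym/eqP; rewrite oner_eq0.
Qed.

End Rayleigh.

(** * Positive definite matrices and weighted norms *)

Section PositiveDefinite.
Context {R : realType} (n : nat).
Implicit Types (M B : 'M[R]_n).

(** The difference of the two sides is [qform M (q *: x - r *: y)] divided by [r * q]. The weights
    are those for which squared norms [r ^+ 2 * a] and [q ^+ 2 * a] give exactly
    [(r + q) ^+ 2 * a]. *)
Lemma young_qform M (x y : 'cV[R]_n) (r q : R) : M^T = M ->
  (forall z, 0 <= qform M z) -> 0 < r -> 0 < q ->
  qform M (x + y) <= (r + q) * (r^-1 * qform M x + q^-1 * qform M y).
Proof.
move=> Ms M0 r0 q0; have h := M0 (q *: x - r *: y).
rewrite -scaleNr qformD// bformZl bformZr !qformZ sqrrN in h.
rewrite qformD// -subr_ge0.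
have -> : (r + q) * (r^-1 * qform M x + q^-1 * qform M y) -
    (qform M x + 2 * bform M x y + qform M y) =
    (r * q)^-1 * (q ^+ 2 * qform M x + 2 * (q * (- r * bform M x y)) +
      r ^+ 2 * qform M y).
  by field; rewrite !gt_eqF.
by rewrite mulr_ge0// invr_ge0 mulr_ge0// ltW.
Qed.

Lemma posdef_unit B : posdef B -> B \in unitmx.
Proof.
move=> [_ B0]; rewrite -row_free_unit -kermx_eq0; apply/rowV0P.
move=> u /sub_kermxP uB.
apply/eqP; apply: contraT => u0.
have := B0 u^T; rewrite /qform trmxK uB mul0mx mxE ltxx; apply.
by rewrite trmx_eq0.
Qed.

Lemma posdef_inv_sym B : posdef B -> (invmx B)^T = invmx B.
Proof. by move=> [Bs _]; rewrite trmx_inv Bs. Qed.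

Lemma qform_invmx B x : posdef B -> qform B (invmx B *m x) = qform (invmx B) x.
Proof.
move=> pB; rewrite -qform_congr posdef_inv_sym//.
by rewrite mulVmx ?posdef_unit// mul1mx.
Qed.

Lemma posdef_qform_ge0 B x : posdef B -> 0 <= qform B x.
Proof. by move=> [_ B0]; have [->|/B0/ltW//] := eqVneq x 0; rewrite qform0. Qed.

Lemma posdef_inv_ge0 B x : posdef B -> 0 <= qform (invmx B) x.
Proof. by move=> pB; rewrite -qform_invmx//; exact: posdef_qform_ge0. Qed.

Lemma sqr_mnorm M x : 0 <= qform M x -> mnorm M x ^+ 2 = qform M x.
Proof. exact: sqr_sqrtr. Qed.

(* Conjugating by the square root of [B] turns the claim into a Rayleigh
   quotient bound for [W] on its range. That root exists: the default value
   [0] would give [W = 0], which has no nonzero eigenvalue. *)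
Lemma qform_ge_lmin B (E : 'M[R]_n) (lmin : R) z : posdef B -> E^T = E ->
  smallest_nonzero_eigenvalue
    (invmx (posdef_sqrt B) *m E *m invmx (posdef_sqrt B)) lmin ->
  lmin * qform (invmx B) (E *m z) <= qform E (invmx B *m (E *m z)).
Proof.
move=> pB Es; rewrite /posdef_sqrt; case: xgetP => [C _ [pC CB]|_]; last first.
  have -> : invmx (0 : 'M[R]_n) = 0.
    rewrite /invmx; case: ifPn => // u0; move: (mulVmx u0).
    by rewrite mulmx0 => m1; rewrite -[LHS]mulmx1 -m1 mulmx0.
  rewrite mul0mx mul0mx => -[/eigenvalueP[v]].
  rewrite mulmx0 => /esym/eqP; rewrite scaler_eq0 => /orP[->//|/eqP->].
  by rewrite eqxx.
set W := _ *m _ => -[_ _ Wl].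
have Cu := posdef_unit pC; have Cs := posdef_inv_sym pC.
have BV : invmx B = invmx C *m invmx C.
  have CCB : invmx C *m invmx C *m B = 1%:M.
    by rewrite -CB mulmxA mulmxKV// mulVmx.
  by rewrite -[RHS](mulmxK (posdef_unit pB)) CCB mul1mx.
have Ws : W^T = W by rewrite /W !trmx_mul Cs Es mulmxA.
(* The argument [C *m z] makes the range element equal to [invmx C *m (E *m z)], whose Euclidean
   norm is the [invmx B]-norm of [E *m z]. *)
have := rayleigh_range Ws Wl (C *m z).
have -> : W *m (C *m z) = invmx C *m (E *m z).
  by rewrite /W !mulmxA mulmxKV.
rewrite -[qform 1%:M _]qform_congr Cs mulmx1 -BV.
by rewrite /W -{1}Cs qform_congr mulmxA -BV.
Qed.

End PositiveDefinite.

(** * The Moore-Penrose pseudoinverse *)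

Section Pseudoinverse.
Context {R : realType}.

(** [M *m X] and [M *m Y] are the same orthogonal projector, and so are [X *m M] and [Y *m M]; hence
    X = XMX = YMX = YMY. *)
Lemma penrose_unique m n (M : 'M[R]_(m, n)) X Y :
  penrose M X -> penrose M Y -> X = Y.
Proof.
move=> [MXM XMX MXs XMs] [MYM YMY MYs YMs].
have MXY : M *m X = M *m Y.
  transitivity (M *m X *m (M *m Y))^T; last by rewrite mulmxA MXM MYs.
  by rewrite trmx_mul MXs MYs mulmxA MYM.
have XYM : X *m M = Y *m M.
  transitivity (Y *m M *m (X *m M))^T.
    by rewrite trmx_mul XMs YMs -mulmxA (mulmxA M) MYM.
  by rewrite -mulmxA (mulmxA M) MXM YMs.
by rewrite -XMX XYM -mulmxA MXY mulmxA YMY.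
Qed.

Lemma penrose_tr m n (M : 'M[R]_(m, n)) X : penrose M X -> penrose M^T X^T.
Proof.
move=> [MXM XMX MXs XMs]; split; rewrite -?trmx_mul ?trmxK.
- by rewrite mulmxA MXM.
- by rewrite mulmxA XMX.
- by rewrite XMs.
- by rewrite MXs.
Qed.

Lemma mp_pinv_sym n (M : 'M[R]_n) : M^T = M -> (mp_pinv M)^T = mp_pinv M.
Proof.
(* The default value [0] of [xget] is symmetric; a genuine pseudoinverse equals its transpose by
   uniqueness. *)
move=> Ms; rewrite /mp_pinv; case: xgetP => [X _ pX|_]; last exact: trmx0.
by apply: penrose_unique (pX); rewrite -[X in penrose X]Ms; exact: penrose_tr.
Qed.

Lemma mp_pinvKr m n (M : 'M[R]_(m, n)) :
  mp_pinv M *m M *m mp_pinv M = mp_pinv M.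
Proof.
by rewrite /mp_pinv; case: xgetP => [X _ []//|_]; rewrite !mul0mx.
Qed.

End Pseudoinverse.

(** * Algebra of one step and of the dual objective *)

Section SketchedProjections.
Context {R : realType} (m n : nat).
Variables (A : 'M[R]_(m, n)) (b : 'cV[R]_m) (B : 'M[R]_n).
Hypothesis B_posdef : posdef B.
Let Bs : (invmx B)^T = invmx B := posdef_inv_sym B_posdef.
Implicit Type s : sketchT R m.

Lemma Hmx_sym s : (Hmx A B s)^T = Hmx A B s.
Proof.
rewrite /Hmx !trmx_mul trmxK mp_pinv_sym ?mulmxA//.
by rewrite !trmx_mul !trmxK Bs !mulmxA.
Qed.

(** Between the two pseudoinverses stands exactly the matrix being inverted, so this is the second
    Penrose equation. *)
Lemma Hmx_idem s :
  Hmx A B s *m (A *m invmx B *m A^T) *m Hmx A B s = Hmx A B s.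
Proof.
by rewrite /Hmx; set S := tagged s; rewrite -[in RHS]mp_pinvKr !mulmxA.
Qed.

Lemma Zmx_sym s : (Zmx A B s)^T = Zmx A B s.
Proof. by rewrite /Zmx trmx_mul (trmx_mul A^T) trmxK Hmx_sym mulmxA. Qed.

Lemma Zmx_idem s : Zmx A B s *m invmx B *m Zmx A B s = Zmx A B s.
Proof. by rewrite /Zmx -[in RHS]Hmx_idem !mulmxA. Qed.

(** By [Hmx_idem] the form is a squared [invmx B]-norm. *)
Lemma qform_Hmx_ge0 s v : 0 <= qform (Hmx A B s) v.
Proof.
have -> : qform (Hmx A B s) v = qform (invmx B) (A^T *m (Hmx A B s *m v)).
  by rewrite -!qform_congr trmxK Hmx_sym Hmx_idem.
exact: posdef_inv_ge0.
Qed.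

Lemma qform_Zmx s x : qform (Zmx A B s) x = qform (Hmx A B s) (A *m x).
Proof. exact: qform_congr. Qed.

Lemma qform_Zmx_ge0 s x : 0 <= qform (Zmx A B s) x.
Proof. by rewrite qform_Zmx qform_Hmx_ge0. Qed.

(** Since Z B^-1 Z = Z, the cross term and the quadratic term are multiples of one form, with
    coefficients -2 omega and omega^2. *)
Lemma qform_exact_step (omega : R) s u :
  qform (invmx B) (u - omega *: (Zmx A B s *m (invmx B *m u))) =
  qform (invmx B) u - omega * (2 - omega) * qform (Zmx A B s) (invmx B *m u).
Proof.
rewrite -scaleNr qformD// bformZr qformZ -qform_congr Zmx_sym Zmx_idem.
have -> : bform (invmx B) u (Zmx A B s *m (invmx B *m u)) =
    qform (Zmx A B s) (invmx B *m u).
  by rewrite /bform /qform trmx_mul Bs !mulmxA.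
ring.
Qed.

Lemma dual_objE x0 y : dual_obj A b B x0 y =
  ((b - A *m x0)^T *m y) 0 0 - 2^-1 * qform (invmx B) (A^T *m y).
Proof. by rewrite /dual_obj sqr_mnorm// posdef_inv_ge0. Qed.

Section DualOptimum.
Variables (x0 : 'cV[R]_n) (ys : 'cV[R]_m).
Hypothesis ysP : forall z, dual_obj A b B x0 z <= dual_obj A b B x0 ys.

(** The gradient of the dual objective vanishes at [ys]: otherwise moving along the residual [r]
    would increase the objective. *)
Lemma dual_optimality : b - A *m x0 = A *m invmx B *m A^T *m ys.
Proof.
set c := b - A *m x0; set r := c - A *m invmx B *m A^T *m ys.
suff: r = 0 by move/eqP; rewrite subr_eq0 => /eqP.
have cE : c = r + A *m invmx B *m A^T *m ys by rewrite /r subrK.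
clearbody r; apply/eqP; rewrite -qform1_eq0.
(* The gap between [ys] and [ys + t *: r] is nonnegative and has linear coefficient minus the
   squared norm of [r], hence the sign change. *)
apply/eqP/(@oppr_inj R); rewrite oppr0.
apply: (@linear_coef_eq0 _ _ (2^-1 * qform (invmx B) (A^T *m r))) => t.
have := ysP (ys + t *: r); rewrite !dual_objE -subr_ge0 -/c.
rewrite !mulmxDr -!scalemxAr qformD// bformZr qformZ.
have -> : (c^T *m ys + t *: (c^T *m r)) 0 0 =
   (c^T *m ys) 0 0 + t * (c^T *m r) 0 0 by rewrite !mxE.
have -> : (c^T *m r) 0 0 =
    qform 1%:M r + bform (invmx B) (A^T *m ys) (A^T *m r).
  rewrite {1}cE linearD /= mulmxDl [LHS]mxE /qform /bform mulmx1.
  by rewrite !trmx_mul !trmxK Bs !mulmxA.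
move=> h; apply: le_trans h _. lra.
Qed.

(** The objective is quadratic with zero gradient at [ys], so only the second-order term remains. *)
Lemma dual_gap y : dual_obj A b B x0 ys - dual_obj A b B x0 y =
  2^-1 * qform (invmx B) (A^T *m (y - ys)).
Proof.
rewrite -[y in LHS](subrK ys) [y - ys + ys]addrC; set v := y - ys; clearbody v.
rewrite !dual_objE dual_optimality !mulmxDr qformD//.
have -> : ((A *m invmx B *m A^T *m ys)^T *m ys +
    (A *m invmx B *m A^T *m ys)^T *m v) 0 0 =
   ((A *m invmx B *m A^T *m ys)^T *m ys) 0 0 +
   bform (invmx B) (A^T *m ys) (A^T *m v).
  by rewrite mxE /bform !trmx_mul !trmxK Bs !mulmxA.
by field.
Qed.

(** Optimality turns the residual into a function of [A^T *m (y - ys)], and the outer [A^T]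
    completes [Hmx] to [Zmx]: the recursion closes on this vector. *)
Lemma isdsa_step_error (omega : R) y s e :
  A^T *m (isdsa_step A b B x0 omega y s e - ys) =
  A^T *m (y - ys) - omega *: (Zmx A B s *m (invmx B *m (A^T *m (y - ys)))) +
  A^T *m e.
Proof.
rewrite /isdsa_step.
have -> : b - A *m (x0 + invmx B *m A^T *m y) =
    - (A *m invmx B *m A^T *m (y - ys)).
  rewrite mulmxDr opprD addrA dual_optimality -!mulmxA -mulmxBr -mulmxBr.
  by rewrite -mulmxBr -mulmxN -mulmxN -mulmxN opprB.
rewrite addrAC [y + _ - ys]addrAC mulmxN scalerN mulmxDr mulmxBr -scalemxAr.
by rewrite /Zmx !mulmxA.
Qed.

End DualOptimum.

End SketchedProjections.

(** * Comparison of integrals and independence *)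

Section Integration.
Context d (T : measurableType d) (R : realType).
Local Open Scope ereal_scope.

Import HBNNSimple.

(** The integral of [g] is a supremum over simple functions below [g]; each of these is almost
    everywhere below the measurable [h]. *)
Lemma le_integral_nonmeasurable (mu : {measure set T -> \bar R})
    (g h : T -> \bar R) :
  (forall w, 0 <= g w) -> (forall w, 0 <= h w) -> measurable_fun setT h ->
  {ae mu, forall w, g w <= h w} -> \int[mu]_w g w <= \int[mu]_w h w.
Proof.
move=> g0 h0 mh gh; rewrite ge0_integralTE//.
apply: ge_ereal_sup => _ [phi phig <-]; rewrite -integralT_nnsfun.
apply: ae_ge0_le_integral => //.
- by move=> w _; rewrite lee_fin.
- exact/measurable_EFinP.
- by apply: filterS gh => w ghw _; apply: le_trans (phig w) ghw.
Qed.

(** Independence makes the joint law the product of the marginals, by uniqueness of product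
    measures; Tonelli gives integrability and Fubini the value. *)
Lemma integral_indep_mul (P : probability T R) (X Y : T -> R) :
  P.-integrable setT (EFin \o X) -> P.-integrable setT (EFin \o Y) ->
  (forall U V, measurable U -> measurable V ->
    P (X @^-1` U `&` Y @^-1` V) = P (X @^-1` U) * P (Y @^-1` V)) ->
  P.-integrable setT (fun w => (X w * Y w)%:E) /\
  \int[P]_w (X w * Y w)%:E = \int[P]_w (X w)%:E * \int[P]_w (Y w)%:E.
Proof.
move=> iX iY XY.
have mX : measurable_fun setT X by exact/measurable_EFinP/(measurable_int _ iX).
have mY : measurable_fun setT Y by exact/measurable_EFinP/(measurable_int _ iY).
have mXY : measurable_fun setT (fun w => (X w, Y w)).
  exact: measurable_fun_pair.
pose X' : {RV P >-> R} := mfun_Sub (mem_set mX).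
pose Y' : {RV P >-> R} := mfun_Sub (mem_set mY).
pose XY' : {RV P >-> (R * R)%type} := mfun_Sub (mem_set mXY).
pose m1 := distribution P X'; pose m2 := distribution P Y'.
have jointE E : measurable E -> (m1 \x m2) E = distribution P XY' E.
  move=> mE.
  exact: (@product_measure_unique _ _ _ _ _ m1 m2 (distribution P XY') XY E mE).
pose f (z : R * R) := (z.1 * z.2)%:E.
have mf : measurable_fun setT f.
  by apply/measurable_EFinP; apply: measurable_funM.
have absI (Z : {RV P >-> R}) : P.-integrable setT (EFin \o Z) ->
    \int[distribution P Z]_x `|x%:E| \is a fin_num.
  move=> iZ; rewrite ge0_integral_distribution//; last exact: measurableT_comp.
  by apply: integrable_fin_num => //; exact: integrable_abse.
have intf : (m1 \x m2).-integrable setT f.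
  apply/integrable12ltyP => //.
  have -> : \int[m1]_x \int[m2]_y `|f (x, y)| =
      \int[m1]_x (`|x%:E| * \int[m2]_y `|y%:E|).
    apply: eq_integral => x _; rewrite -ge0_integralZl//.
      by apply: eq_integral => y _; rewrite /f EFinM abseM.
    exact: measurableT_comp.
  rewrite ge0_integralZr//; last 2 first.
  - exact: measurableT_comp.
  - exact: integral_ge0.
  by rewrite ltey_eq fin_numM//; exact: absI.
have iXY : P.-integrable setT (fun w => (X w * Y w)%:E).
  apply/integrableP; split.
    by apply/measurable_EFinP; exact: measurable_funM.
  have := integrableP _ _ _ intf => -[_].
  rewrite (@eq_measure_integral _ _ _ _ (distribution P XY')); last first.
    by move=> E mE _; exact: jointE.
  by rewrite ge0_integral_distribution//; exact: measurableT_comp.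
split=> //.
transitivity (\int[distribution P XY']_z f z).
  by rewrite integral_distribution.
rewrite -(@eq_measure_integral _ _ _ _ (distribution P XY') (m1 \x m2));
  last first.
  by move=> E mE _; exact: jointE.
rewrite -integral12_prod_meas1//= /fubini_F /f /=.
have iid (Z : {RV P >-> R}) : P.-integrable setT (EFin \o Z) ->
    (distribution P Z).-integrable setT EFin.
  by move=> iZ; apply: integrable_pushforward.
have IE (Z : {RV P >-> R}) : P.-integrable setT (EFin \o Z) ->
    \int[distribution P Z]_x x%:E = \int[P]_w (Z w)%:E.
  by move=> iZ; rewrite integral_distribution.
have -> : \int[m1]_x \int[m2]_y (x * y)%:E =
    \int[m1]_x (x%:E * (fine (\int[P]_w (Y w)%:E))%:E).
  apply: eq_integral => x _; under eq_integral do rewrite EFinM.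
  rewrite integralZl//; last exact: iid.
  by rewrite IE// fineK//; exact: integrable_fin_num.
rewrite integralZr//; last exact: iid.
by rewrite IE// fineK//; exact: integrable_fin_num.
Qed.

End Integration.

(** * Entrywise measurability of random matrices *)

Section MeasurableMatrices.
Context d (T : measurableType d) (R : realType).

Definition mx_measurable p n (M : T -> 'M[R]_(p, n)) : Prop :=
  forall i j, measurable_fun setT (fun w => M w i j).

Lemma mx_measurable_cst p n (M : 'M[R]_(p, n)) : mx_measurable (fun=> M).
Proof. by move=> i j; exact: measurable_cst. Qed.

Lemma mx_measurableD p n (M N : T -> 'M[R]_(p, n)) :
  mx_measurable M -> mx_measurable N -> mx_measurable (fun w => M w + N w).
Proof.
move=> mM mN i j; under eq_fun do rewrite mxE; exact: measurable_funD.
Qed.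

Lemma mx_measurableM p n l (M : T -> 'M[R]_(p, n)) (N : T -> 'M[R]_(n, l)) :
  mx_measurable M -> mx_measurable N -> mx_measurable (fun w => M w *m N w).
Proof.
move=> mM mN i j; under eq_fun do rewrite mxE.
by apply: measurable_sum => k; exact: measurable_funM.
Qed.

Lemma mx_measurableMl p n l (M : 'M[R]_(p, n)) (N : T -> 'M[R]_(n, l)) :
  mx_measurable N -> mx_measurable (fun w => M *m N w).
Proof. by apply: mx_measurableM; exact: mx_measurable_cst. Qed.

Lemma mx_measurableZ p n a (M : T -> 'M[R]_(p, n)) :
  mx_measurable M -> mx_measurable (fun w => a *: M w).
Proof.
move=> mM i j; under eq_fun do rewrite mxE.
by apply: measurable_funM => //; exact: measurable_cst.
Qed.

Lemma measurable_qform n (M : T -> 'M[R]_n) (x : T -> 'cV[R]_n) :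
  mx_measurable M -> mx_measurable x ->
  measurable_fun setT (fun w => qform (M w) (x w)).
Proof.
move=> mM mx; under eq_fun do rewrite qformE bformE.
apply: measurable_sum => i; apply: measurable_sum => j.
by apply: measurable_funM => //; exact: measurable_funM.
Qed.

End MeasurableMatrices.

(** * Cauchy-Schwarz and coordinate bounds *)

Section CauchySchwarz.
Context {R : realType} (n : nat).

(** [M] is only semidefinite, so [qform M y] may vanish for nonzero [y]; then the cross term must
    vanish too, being the linear coefficient of a nonnegative polynomial. *)
Lemma cauchy_schwarz_qform (M : 'M[R]_n) x y : M^T = M ->
  (forall z, 0 <= qform M z) -> bform M x y ^+ 2 <= qform M x * qform M y.
Proof.
move=> Ms M0; have [y0|y0] := eqVneq (qform M y) 0.
  rewrite y0 mulr0.
  suff -> : bform M x y = 0 by rewrite expr0n.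
  suff: 2 * bform M x y = 0 by lra.
  apply: (@linear_coef_eq0 _ _ (qform M x)) => t.
  have := M0 (y + t *: x).
  by rewrite qformD// y0 bformZr qformZ (bformC y x Ms); lra.
have yp : 0 < qform M y by rewrite lt_def y0 M0.
have := M0 (qform M y *: x - bform M x y *: y).
rewrite -scaleNr qformD// bformZl bformZr !qformZ => h.
by rewrite -subr_ge0 -(pmulr_rge0 _ yp); apply: le_trans h _; lra.
Qed.

(** A coordinate of [invmx B *m u] is the [invmx B]-product of [u] with a basis vector. *)
Lemma coord_sqr_le (B : 'M[R]_n) : posdef B ->
  exists c : 'I_n -> R, forall i u,
    (invmx B *m u) i 0 ^+ 2 <= c i * qform (invmx B) u.
Proof.
move=> pB; exists (fun i => qform (invmx B) (delta_mx i 0)) => i u.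
have -> : (invmx B *m u) i 0 = bform (invmx B) (delta_mx i 0) u.
  by rewrite /bform trmx_delta -mulmxA -rowE [RHS]mxE.
apply: cauchy_schwarz_qform; first exact: posdef_inv_sym.
by move=> z; exact: posdef_inv_ge0.
Qed.

End CauchySchwarz.

(** * Integrals of random quadratic forms *)

Section IntegralQform.
Context d (T : measurableType d) (R : realType).
Context (mu : {measure set T -> \bar R}) (n : nat).
Context (M : T -> 'M[R]_n) (x : T -> 'cV[R]_n).
Hypothesis Mx : forall i j,
  mu.-integrable setT (fun w => (x w i 0 * M w i j * x w j 0)%:E).

Lemma integrable_qform :
  mu.-integrable setT (fun w => (qform (M w) (x w))%:E).
Proof.
under eq_fun.
  move=> w; rewrite qformE bformE -sumEFin.
  under eq_bigr do rewrite -sumEFin.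
  over.
by apply: integrable_sum => // i _; apply: integrable_sum.
Qed.

Lemma integral_qform : (\int[mu]_w (qform (M w) (x w))%:E =
  \sum_i \sum_j \int[mu]_w (x w i 0 * M w i j * x w j 0)%:E)%E.
Proof.
under eq_integral.
  move=> w _; rewrite qformE bformE -sumEFin.
  under eq_bigr do rewrite -sumEFin.
  over.
rewrite integral_sum//; last by move=> i; apply: integrable_sum.
by apply: eq_bigr => i _; rewrite integral_sum.
Qed.

End IntegralQform.

(** * Mean contraction of the exact step *)

Section MeanSketch.
Context {R : realType} (m n : nat).
Variables (A : 'M[R]_(m, n)) (b : 'cV[R]_m) (B : 'M[R]_n).
Variable mu : probability (sketchT R m) R.
Hypothesis B_posdef : posdef B.
Hypothesis EZ_exists : forall i j : 'I_n,
  mu.-integrable setT (fun s => (Zmx A B s i j)%:E).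

Lemma measurable_Zmx : mx_measurable (Zmx A B).
Proof.
move=> i j; apply/measurable_EFinP.
exact: (measurable_int _ (EZ_exists i j)).
Qed.

Lemma EZE i j : (EZ A B mu i j)%:E = (\int[mu]_s (Zmx A B s i j)%:E)%E.
Proof.
by rewrite mxE unlock fineK//; exact: integrable_fin_num (EZ_exists i j).
Qed.

Lemma EZ_sym : (EZ A B mu)^T = EZ A B mu.
Proof.
apply/matrixP => i j; rewrite [LHS]mxE; apply: EFin_inj; rewrite !EZE.
by apply: eq_integral => s _; rewrite -[in LHS](Zmx_sym A B_posdef) mxE.
Qed.

Lemma integral_qform_Zmx x :
  (\int[mu]_s (qform (Zmx A B s) x)%:E = (qform (EZ A B mu) x)%:E)%E.
Proof.
have coefE i j s : (x i 0 * Zmx A B s i j * x j 0)%:E =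
    ((x i 0 * x j 0)%:E * (Zmx A B s i j)%:E)%E by rewrite mulrAC EFinM.
rewrite integral_qform; last first.
  move=> i j; under eq_fun do rewrite coefE.
  by apply: integrableZl => //; exact: EZ_exists.
rewrite qformE bformE -sumEFin; apply: eq_bigr => i _.
rewrite -sumEFin; apply: eq_bigr => j _.
under eq_integral do rewrite coefE.
rewrite integralZl//.
by rewrite -EZE mulrAC EFinM.
Qed.

Hypothesis consistent : exists x : 'cV[R]_n, A *m x = b.
Hypothesis exact : exactness A b B mu.

(** Shifting a solution by [x] keeps the mean objective at 0, its least possible value, so exactness
    makes the shifted point a solution. *)
Lemma EZ_ker (x : 'cV[R]_n) : EZ A B mu *m x = 0 -> A *m x = 0.
Proof.
move=> Ex; have [x1 Ax1] := consistent.
suff : solution_set A b (x1 + x).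
  by rewrite /solution_set /= mulmxDr Ax1 -[in RHS](addr0 b) => /addrI.
rewrite -exact /= => z; have -> : f_mean A b B mu (x1 + x) = 0%E.
  rewrite /f_mean unlock /f_sketch mulmxDr Ax1 addrAC subrr add0r.
  under eq_integral do rewrite -qform_Zmx EFinM.
  rewrite ge0_integralZl//.
  - by rewrite integral_qform_Zmx /qform -mulmxA Ex mulmx0 mxE mule0.
  - apply/measurable_EFinP/measurable_qform; first exact: measurable_Zmx.
    exact: mx_measurable_cst.
  - by move=> s _; rewrite lee_fin qform_Zmx_ge0.
by apply: expectation_ge0 => s; rewrite /f_sketch mulr_ge0// qform_Hmx_ge0//.
Qed.

(** Dual form of [EZ_ker]: the kernel inclusion puts the rows of [A] in the row space of the mean,
    and symmetry turns rows into columns. *)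
Lemma EZ_range (v : 'cV[R]_m) : exists z, A^T *m v = EZ A B mu *m z.
Proof.
have /submxP[D AD] : (A <= EZ A B mu)%MS.
  rewrite submxE; apply/eqP/matrixP => i j.
  have EK : EZ A B mu *m (cokermx (EZ A B mu) *m delta_mx j (0 : 'I_1)) = 0.
    by rewrite mulmxA mulmx_coker mul0mx.
  by have := EZ_ker EK; rewrite mulmxA -colE => /matrixP/(_ i 0); rewrite !mxE.
exists (D^T *m v).
by rewrite {1}AD trmx_mul EZ_sym mulmxA.
Qed.

Variable lmin : R.
Hypothesis lminP : smallest_nonzero_eigenvalue (Wmx A B mu) lmin.

Lemma qform_EZ_ge v : lmin * qform (invmx B) (A^T *m v) <=
  qform (EZ A B mu) (invmx B *m (A^T *m v)).
Proof.
have [z ->] := EZ_range v.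
by apply: qform_ge_lmin => //; exact: EZ_sym.
Qed.

Context d (Omega : measurableType d) (P : probability Omega R).
Variables (S : {RV P >-> sketchT R m}) (v : Omega -> 'cV[R]_m).
Hypothesis S_law : forall E : set (sketchT R m), measurable E ->
  distribution P S E = mu E.
Let u w := A^T *m v w.
Let x w := invmx B *m u w.
Hypothesis u_meas : mx_measurable u.
Hypothesis u_fin : (\int[P]_w (qform (invmx B) (u w))%:E < +oo)%E.
(** Products of two coordinates suffice: they are the factors of the entries of [Zmx] when the form
    is expanded. *)
Hypothesis indep : forall i j E V, measurable E -> measurable V ->
  (P (S @^-1` E `&` (fun w => x w i 0 * x w j 0)%R @^-1` V) =
   P (S @^-1` E) * P ((fun w => x w i 0 * x w j 0)%R @^-1` V))%E.

Let x_meas : mx_measurable x. Proof. exact: mx_measurableMl. Qed.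

Let N_meas : measurable_fun setT (fun w => qform (invmx B) (u w)).
Proof. by apply: measurable_qform => //; exact: mx_measurable_cst. Qed.

Let N_ge0 w : 0 <= qform (invmx B) (u w). Proof. exact: posdef_inv_ge0. Qed.

Let iN : P.-integrable setT (fun w => (qform (invmx B) (u w))%:E).
Proof.
apply/integrableP; split; first exact/measurable_EFinP.
by under eq_integral do rewrite gee0_abs ?lee_fin//.
Qed.

Lemma integrable_coord_mul i j :
  P.-integrable setT (fun w => (x w i 0 * x w j 0)%:E).
Proof.
have [c cP] := coord_sqr_le B_posdef.
(* A product of two coordinates is at most half the sum of their squares, each bounded by
   [coord_sqr_le]. *)
apply: (@le_integrable _ _ _ _ _ measurableT _
    (fun w => (2^-1 * (c i + c j))%:E * (qform (invmx B) (u w))%:E)%E).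
- by apply/measurable_EFinP; exact: measurable_funM.
- move=> w _; rewrite -EFinM !abse_EFin lee_fin.
  apply: le_trans (ler_norm _); rewrite normrM.
  have := cP i (u w); have := cP j (u w); rewrite -/(x w).
  rewrite -[x w i 0 ^+ 2]real_normK ?num_real//.
  rewrite -[x w j 0 ^+ 2]real_normK ?num_real//.
  have := sqr_ge0 (`|x w i 0| - `|x w j 0|).
  rewrite sqrrB; lra.
- exact: integrableZl.
Qed.

(** Independence replaces a sampled entry by its mean, one entry at a time; [S_law] transports
    integrals from [mu] to [P]. *)
Lemma integral_Zmx_coord i j :
  P.-integrable setT (fun w => (x w i 0 * Zmx A B (S w) i j * x w j 0)%:E) /\
  (\int[P]_w (x w i 0 * Zmx A B (S w) i j * x w j 0)%:E =
   \int[P]_w (x w i 0 * EZ A B mu i j * x w j 0)%:E)%E.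
Proof.
have iZ : P.-integrable setT (EFin \o (fun w => Zmx A B (S w) i j)).
  apply/integrableP; split.
    apply/measurable_EFinP; apply: (measurableT_comp (measurable_Zmx i j)).
    exact: measurable_funP.
  have /integrableP[mZ] := EZ_exists i j.
  rewrite (@eq_measure_integral _ _ _ _ (distribution P S)); last first.
    by move=> E mE _; exact/esym/S_law.
  by rewrite ge0_integral_distribution//; exact: measurableT_comp.
have EZS : (\int[P]_w (Zmx A B (S w) i j)%:E = (EZ A B mu i j)%:E)%E.
  rewrite EZE (@eq_measure_integral _ _ _ _ (distribution P S)); last first.
    by move=> E mE _; exact/esym/S_law.
  rewrite integral_distribution//.
  exact: (measurable_int _ (EZ_exists i j)).
have [U V mU mV|iM IM] := integral_indep_mul iZ (integrable_coord_mul i j).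
  apply: (indep i j (E := (fun s => Zmx A B s i j) @^-1` U)) => //.
  by rewrite -[X in measurable X]setTI; exact: measurable_Zmx.
have ZE w : x w i 0 * Zmx A B (S w) i j * x w j 0 =
  Zmx A B (S w) i j * (x w i 0 * x w j 0) by ring.
split; first by under eq_fun do rewrite ZE.
under eq_integral do rewrite ZE.
rewrite IM EZS -integralZl//; last exact: integrable_coord_mul.
by apply: eq_integral => w _; rewrite -EFinM; congr EFin; ring.
Qed.

Lemma integrable_qform_Zmx :
  P.-integrable setT (fun w => (qform (Zmx A B (S w)) (x w))%:E).
Proof.
by apply: integrable_qform => i j; have [] := integral_Zmx_coord i j.
Qed.

(** Once the mean matrix has replaced the sample, the Rayleigh bound [qform_EZ_ge] holds
    pointwise. *)
Lemma integral_qform_Zmx_ge :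
  (lmin%:E * \int[P]_w (qform (invmx B) (u w))%:E <=
   \int[P]_w (qform (Zmx A B (S w)) (x w))%:E)%E.
Proof.
have iE i j : P.-integrable setT
    (fun w => (x w i 0 * EZ A B mu i j * x w j 0)%:E).
  have -> : (fun w => (x w i 0 * EZ A B mu i j * x w j 0)%:E) =
      (fun w => (EZ A B mu i j)%:E * (x w i 0 * x w j 0)%:E)%E.
    by apply/funext => w; rewrite -EFinM; congr EFin; ring.
  by apply: integrableZl => //; exact: integrable_coord_mul.
rewrite [leRHS]integral_qform; last first.
  by move=> i j; have [] := integral_Zmx_coord i j.
under eq_bigr do under eq_bigr do rewrite (integral_Zmx_coord _ _).2.
rewrite -(@integral_qform _ _ _ _ _ (fun=> EZ A B mu) x)//.
rewrite -integralZl//; apply: le_integral => //.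
- exact: integrableZl.
- exact: (@integrable_qform _ _ _ _ _ (fun=> EZ A B mu) x).
- by move=> w _; rewrite -EFinM lee_fin; exact: qform_EZ_ge.
Qed.

Lemma mean_exact_step (omega : R) : 0 < omega -> omega < 2 ->
  (\int[P]_w (qform (invmx B) (u w - omega *: (Zmx A B (S w) *m x w)))%:E <=
   (1 - omega * (2 - omega) * lmin)%:E *
   \int[P]_w (qform (invmx B) (u w))%:E)%E.
Proof.
move=> w0 w2; set g := omega * (2 - omega).
have g0 : 0 <= g by rewrite mulr_ge0 ?subr_ge0 ?ltW.
under eq_integral do rewrite qform_exact_step// EFinB EFinM.
have iZ := integrable_qform_Zmx.
rewrite integralB//; last exact: integrableZl.
rewrite integralZl//.
have := integral_qform_Zmx_ge.
have := integrable_fin_num measurableT iN.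
have := integrable_fin_num measurableT iZ.
move/fineK => <- /fineK <-; rewrite -!EFinM !lee_fin => h.
by rewrite mulrBl mul1r lerD2l lerN2 -mulrA ler_wpM2l.
Qed.

End MeanSketch.

(** * Minkowski's inequality in mean square *)

Lemma le_sqr_limit (R : realType) (x s a : R) : 0 <= s -> 0 <= a ->
  (forall e, 0 < e -> x <= (s + 2 * e) ^+ 2 * a) -> x <= s ^+ 2 * a.
Proof.
move=> s0 a0 h; apply/ler_addgt0Pr => e e0.
have K0 : 0 < 4 * (s + 1) * a + 1.
  by rewrite ltr_wpDl// mulr_ge0// mulr_ge0// addr_ge0.
(* For [t <= 1] the excess [4 * s * t * a + 4 * t ^+ 2 * a] is at most [4 * (s + 1) * a * t], hence
   at most [e]. *)
pose t := Num.min 1 (e / (4 * (s + 1) * a + 1)).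
have t0 : 0 < t by rewrite lt_min ltr01 divr_gt0.
have t1 : t <= 1 by rewrite ge_min lexx.
have te : t * (4 * (s + 1) * a + 1) <= e.
  by rewrite -ler_pdivlMr// ge_min lexx orbT.
apply: le_trans (h _ t0) _.
have tta : t * t * a <= t * a by rewrite -mulrA ler_piMl// mulr_ge0// ltW.
nra.
Qed.

(* Minkowski's inequality in [L^2], through Young's inequality with weights
   [r + t] and [q + t], which stay positive when [r] or [q] vanishes. *)
Lemma integral_qform_add_le d (T : measurableType d) (R : realType)
    (mu : {measure set T -> \bar R}) n (M : 'M[R]_n) (x y : T -> 'cV[R]_n)
    (r q a : R) :
  M^T = M -> (forall z, 0 <= qform M z) ->
  mx_measurable x -> mx_measurable y -> 0 <= r -> 0 <= q -> 0 <= a ->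
  (\int[mu]_w (qform M (x w))%:E <= (r ^+ 2 * a)%:E)%E ->
  (\int[mu]_w (qform M (y w))%:E <= (q ^+ 2 * a)%:E)%E ->
  (\int[mu]_w (qform M (x w + y w))%:E <= ((r + q) ^+ 2 * a)%:E)%E.
Proof.
move=> Ms M0 mx my r0 q0 a0 Ix Iy.
have mq z : mx_measurable z ->
    measurable_fun setT (fun w : T => (qform M (z w))%:E).
  move=> mz; apply/measurable_EFinP.
  exact: (measurable_qform (@mx_measurable_cst _ _ _ _ _ M) mz).
have I0 (z : T -> 'cV[R]_n) : (0 <= \int[mu]_w (qform M (z w))%:E)%E.
  by apply: integral_ge0 => w _; rewrite lee_fin.
have young t : 0 < t ->
    (\int[mu]_w (qform M (x w + y w))%:E <= ((r + q + 2 * t) ^+ 2 * a)%:E)%E.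
  move=> t0; pose r' := r + t; pose q' := q + t.
  have r'0 : 0 < r' by rewrite ltr_wpDl.
  have q'0 : 0 < q' by rewrite ltr_wpDl.
  apply: (@le_trans _ _ (\int[mu]_w
      ((r' + q')%:E * (r'^-1%:E * (qform M (x w))%:E +
                       q'^-1%:E * (qform M (y w))%:E)))%E).
    apply: ge0_le_integral => //.
    - by move=> w _; rewrite lee_fin.
    - by apply: mq; exact: mx_measurableD.
    - by apply: measurable_funeM; apply: emeasurable_funD;
        apply: measurable_funeM; exact: mq.
    - by move=> w _; rewrite -!EFinM lee_fin; exact: young_qform.
  rewrite ge0_integralZl//; last 3 first.
  - by apply: emeasurable_funD; apply: measurable_funeM; exact: mq.
  - move=> w _; rewrite -!EFinM -EFinD lee_fin.
    by rewrite addr_ge0// mulr_ge0// invr_ge0 ltW.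
  - by rewrite lee_fin addr_ge0// ltW.
  rewrite ge0_integralD//; last 4 first.
  - by move=> w _; rewrite -!EFinM lee_fin mulr_ge0// invr_ge0 ltW.
  - by apply: measurable_funeM; exact: mq.
  - by move=> w _; rewrite -!EFinM lee_fin mulr_ge0// invr_ge0 ltW.
  - by apply: measurable_funeM; exact: mq.
  rewrite !ge0_integralZl ?lee_fin ?invr_ge0 ?(ltW r'0) ?(ltW q'0)//;
    last 4 first.
  - exact: mq.
  - by move=> w _; rewrite lee_fin.
  - exact: mq.
  - by move=> w _; rewrite lee_fin.
  (* Each weighted integral contributes at most its weight times [a], so both together give
     [(r' + q') ^+ 2 * a]. *)
  have sc (c c' : R) (I : \bar R) : 0 <= c -> c < c' ->
      (I <= (c ^+ 2 * a)%:E)%E -> (c'^-1%:E * I <= (c' * a)%:E)%E.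
    move=> c0 cc' Ile; have c'0 : 0 < c' by apply: le_lt_trans cc'.
    apply: (@le_trans _ _ (c'^-1%:E * (c ^+ 2 * a)%:E)%E).
      by apply: lee_wpmul2l => //; rewrite lee_fin invr_ge0 ltW.
    rewrite -EFinM lee_fin mulrA ler_wpM2r// ler_pdivrMl// -expr2.
    by rewrite lerXn2r ?nnegrE// ltW.
  apply: (@le_trans _ _ ((r' + q')%:E * ((r' * a)%:E + (q' * a)%:E))%E).
    apply: lee_wpmul2l; first by rewrite lee_fin addr_ge0// ltW.
    by apply: leeD; [apply: sc Ix|apply: sc Iy] => //; rewrite /r' /q' ltrDl.
  rewrite -EFinD -EFinM lee_fin /r' /q'.
  by rewrite le_eqVlt; apply/orP; left; apply/eqP; ring.
(* The case [t = 1] gives finiteness; then [t] tends to 0 among reals. *)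
have Ifin : (\int[mu]_w (qform M (x w + y w))%:E)%E \is a fin_num.
  rewrite ge0_fin_numE; last exact: I0.
  exact: le_lt_trans (young _ ltr01) (ltry _).
rewrite -(fineK Ifin) lee_fin; apply: le_sqr_limit => //; first exact: addr_ge0.
by move=> t /young; rewrite -{1}(fineK Ifin) lee_fin.
Qed.

Theorem theorem9 (R : realType) (m n : nat)
  (A : 'M[R]_(m, n)) (b : 'cV[R]_m) (B : 'M[R]_n) (x0 : 'cV[R]_n)
  (consistent : exists x : 'cV[R]_n, A *m x = b)
  (B_posdef : posdef B)
  (mu : probability (sketchT R m) R)
  (EZ_exists : forall i j : 'I_n,
     mu.-integrable setT (fun s => (Zmx A B s i j)%:E))
  (exact : exactness A b B mu)
  (lmin : R) (lminP : smallest_nonzero_eigenvalue (Wmx A B mu) lmin)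
  (omega : R) (omega_gt0 : 0 < omega) (omega_lt2 : omega < 2)
  (d : measure_display) (Omega : measurableType d) (P : probability Omega R)
  (S : nat -> {RV P >-> sketchT R m})
  (S_law : forall (k : nat) (E : set (sketchT R m)), measurable E ->
     distribution P (S k) E = mu E)
  (eps : nat -> Omega -> 'cV[R]_m)
  (eps_measurable : forall (k : nat) (i : 'I_m),
     measurable_fun setT (fun w => eps k w i 0))
  (y : nat -> Omega -> 'cV[R]_m)
  (y_def : y = isdsa A b B x0 omega S eps)
  (S_fresh : forall k : nat,
     independent P <<s sample_events (S k) >> <<s past_events y S k >>)
  (xs : 'cV[R]_n) (xsP : is_projection (solution_set A b) B x0 xs)
  (ys : 'cV[R]_m)
  (ysP : forall z, dual_obj A b B x0 z <= dual_obj A b B x0 ys)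
  (rho : R) (rho_def : rho = 1 - omega * (2 - omega) * lmin)
  (q : R) (q_ge0 : 0 <= q) (q_lt : q < 1 - Num.sqrt rho)
  (eps_bound : forall k : nat, exists g : Omega -> \bar R,
     is_cond_exp P <<s vector_events (y k) `|` sample_events (S k) >>
       (fun w => (mnorm B (invmx B *m A^T *m eps k w) ^+ 2)%:E) g /\
     {ae P, forall w,
        (g w <= (2 * q ^+ 2 *
                 (dual_obj A b B x0 ys - dual_obj A b B x0 (y k w)))%:E)%E})
  (k : nat) :
  ('E_P[(fun w => dual_obj A b B x0 ys - dual_obj A b B x0 (y k w))%R] <=
    ((Num.sqrt rho + q) ^+ (2 * k) *
     (dual_obj A b B x0 ys - dual_obj A b B x0 0))%:E)%E.
Proof.
pose u j w := A^T *m (y j w - ys).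
pose N := qform (invmx B).
have Bs := posdef_inv_sym B_posdef.
have N0 z : 0 <= N z by exact: posdef_inv_ge0.
have gapE j w :
    dual_obj A b B x0 ys - dual_obj A b B x0 (y j w) = 2^-1 * N (u j w).
  exact: dual_gap.
have u0 w : u 0%N w = A^T *m (0 - ys) by rewrite /u y_def.
have uS j w : u j.+1 w =
    u j w - omega *: (Zmx A B (S j w) *m (invmx B *m u j w)) + A^T *m eps j w.
  by rewrite /u {1}y_def /= -y_def isdsa_step_error.
have meps j : mx_measurable (fun w => A^T *m eps j w).
  by apply: mx_measurableMl => i i'; rewrite (ord1 i'); exact: eps_measurable.
have mZ j : mx_measurable (fun w => Zmx A B (S j w)).
  move=> i i'; apply: (measurableT_comp (measurable_Zmx EZ_exists i i')).
  exact: measurable_funP.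
have mp j : mx_measurable (u j) -> mx_measurable
    (fun w => u j w - omega *: (Zmx A B (S j w) *m (invmx B *m u j w))).
  move=> mu_; under eq_fun do rewrite -scaleNr.
  apply: mx_measurableD => //; apply: mx_measurableZ.
  by apply: mx_measurableM => //; exact: mx_measurableMl.
have mu_ j : mx_measurable (u j).
  elim: j => [|j IH].
    have -> : u 0%N = fun=> A^T *m (0 - ys) by apply/funext => w; exact: u0.
    exact: mx_measurable_cst.
  have -> : u j.+1 = fun w => u j w -
      omega *: (Zmx A B (S j w) *m (invmx B *m u j w)) + A^T *m eps j w.
    by apply/funext => w; rewrite uS.
  by apply: mx_measurableD => //; exact: mp.
have mN j : measurable_fun setT (fun w => N (u j w)).
  exact: (measurable_qform (@mx_measurable_cst _ _ _ _ _ (invmx B)) (mu_ j)).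
have indep j i i' E V : measurable E -> measurable V ->
    let f w := (invmx B *m u j w) i 0 * (invmx B *m u j w) i' 0 in
    (P (S j @^-1` E `&` f @^-1` V) = P (S j @^-1` E) * P (f @^-1` V))%E.
  move=> mE mV f; apply: (S_fresh j).
    by apply: sub_sigma_algebra; exists E => //; rewrite setTI.
  (* With the past as sigma-algebra, [y j] is measurable by construction, so the events of [f]
     belong to the history that [S_fresh] separates from [S j]. *)
  pose past := g_sigma_algebraType (past_events y S j).
  have my : mx_measurable (fun w : past => y j w).
    move=> l l' _ U mU; rewrite (ord1 l') setTI.
    apply: sub_sigma_algebra; left; exists j => /=; first by rewrite ltnS.
    by exists l => //; exists U => //; rewrite setTI.
  have mv : mx_measurable (fun w : past => invmx B *m u j w).
    apply: mx_measurableMl; apply: mx_measurableMl; apply: mx_measurableD => //.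
  have mf : measurable_fun [set: past] f by exact: measurable_funM.
  by have := mf measurableT V mV; rewrite setTI.
have eps_le j : (\int[P]_w (N (A^T *m eps j w))%:E <=
    (q ^+ 2)%:E * \int[P]_w (N (u j w))%:E)%E.
  have [g [[g0 _ gE] g_le]] := eps_bound j.
  have <- : (\int[P]_w g w = \int[P]_w (N (A^T *m eps j w))%:E)%E.
    (* The defining property of the conditional expectation is tested on the whole space. *)
    rewrite gE; last exact: (@measurableT _ (g_sigma_algebraType _)).
    apply: eq_integral => w _.
    by rewrite sqr_mnorm ?posdef_qform_ge0// -mulmxA qform_invmx.
  rewrite -ge0_integralZl//; last 3 first.
  - exact/measurable_EFinP.
  - by move=> w _; rewrite lee_fin.
  - by rewrite lee_fin sqr_ge0.
  apply: le_integral_nonmeasurable => //.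
  - by move=> w; rewrite -EFinM lee_fin mulr_ge0// sqr_ge0.
  - by apply: measurable_funeM; exact/measurable_EFinP.
  - apply: filterS g_le => w; rewrite gapE -EFinM.
    by rewrite (_ : 2 * q ^+ 2 * _ = q ^+ 2 * N (u j w))//; field.
have s0 := sqrtr_ge0 rho; set s := Num.sqrt rho in s0 *.
(* An inequality covers both signs, as [Num.sqrt] is 0 at negative numbers. *)
have rho_le : rho <= s ^+ 2.
  have [r0|r0] := leP 0 rho; first by rewrite sqr_sqrtr.
  by rewrite (le_trans (ltW r0))// sqr_ge0.
have key j : (\int[P]_w (N (u j w))%:E <=
    ((s + q) ^+ (2 * j) * N (A^T *m (0 - ys)))%:E)%E.
  elim: j => [|j IH].
    rewrite muln0 expr0 mul1r; under eq_integral do rewrite u0.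
    by rewrite integral_cst//= probability_setT mule1.
  (* The induction hypothesis also supplies the finite second moment that the mean contraction
     requires. *)
  have Ifin : (\int[P]_w (N (u j w))%:E)%E \is a fin_num.
    rewrite ge0_fin_numE; first exact: le_lt_trans IH (ltry _).
    by apply: integral_ge0 => w _; rewrite lee_fin.
  set a := fine (\int[P]_w (N (u j w))%:E)%E.
  have aE : (\int[P]_w (N (u j w))%:E = a%:E)%E by rewrite fineK.
  have a0 : 0 <= a.
    by rewrite fine_ge0// integral_ge0// => w _; rewrite lee_fin.
  rewrite aE lee_fin in IH.
  apply: (@le_trans _ _ ((s + q) ^+ 2 * a)%:E).
    under eq_integral do rewrite uS.
    (* Minkowski with factor [s] for the exact part and [q] for the error. *)
    apply: integral_qform_add_le => //.
    - exact: mp.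
    - apply: le_trans (@mean_exact_step _ _ _ _ b _ _ B_posdef EZ_exists
        consistent exact lmin lminP _ _ P (S j) _ (S_law j) (mu_ j) _
        (indep j) omega omega_gt0 omega_lt2) _.
        by rewrite -/N aE ltry.
      by rewrite -/N aE -EFinM -rho_def lee_fin ler_wpM2r.
    - by apply: le_trans (eps_le j) _; rewrite aE -EFinM.
  by rewrite lee_fin mulnS exprD -mulrA ler_wpM2l// sqr_ge0.
(* Back to dual gaps: both sides carry the same factor 1/2. *)
rewrite unlock; under eq_integral do rewrite gapE EFinM.
rewrite ge0_integralZl//; last 2 first.
- exact/measurable_EFinP.
- by move=> w _; rewrite lee_fin.
rewrite (dual_gap B_posdef ysP) mulrCA EFinM.
by apply: lee_wpmul2l; [rewrite lee_fin|exact: key].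
Qed.
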